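(* Let $\bar m\ge 3$ be an integer. Let $F$ be a social choice rule defined for every finite nonempty electorate $N\subset\mathcal N$ and every nonempty set $A\subset\mathcal A$ of alternatives with at most $\bar m$ elements. Then $F$ satisfies Anonymity, Neutrality, Consistency, and $1$-Clone Invariance if and only if $F$ is the Plurality rule, i.e. for every such $N$, $A$ and every profile $\succ\,\in\mathcal L(A)^N$, $F(\succ)$ is the set of alternatives in $A$ that are ranked first by the largest number of voters in $N$.
   Context: Setting. $\mathcal N$ and $\mathcal A$ are infinite sets of potential voters and potential alternatives. An electorate is a finite nonempty $N\subset\mathcal N$; an alternative set is a finite nonempty $A\subset\mathcal A$. $\mathcal L(A)$ is the set of strict linear orders on $A$ (asymmetric, transitive, complete on distinct alternatives). A profile is $\succ\,=(\succ_i)_{i\in N}\in\mathcal L(A)^N$. The rank of $a\in A$ for voter $i$ is $r_i(a,\succ)=1+|\{b\in A: b\succ_i a\}|$. For $B\subseteq A$, $\succ|_B$ is the profile of the restrictions of the orders $\succ_i$ to $B$. A social choice rule $F$ assigns to every profile (for every electorate $N$ and every alternative set $A$ in its domain) a nonempty set $F(\succ)\subseteq A$. Transformations. For a bijection $\pi:N\to N'$ between electorates, $\pi\succ$ is the profile on $N'$ with $(\pi\succ)_{\pi(i)}=\succ_i$. For a permutation $\sigma:A\to A$, $\sigma\succ$ is the profile with $\sigma(a)\,(\sigma\succ_i)\,\sigma(b)\iff a\succ_i b$. For profiles $\succ\in\mathcal L(A)^N$ and $\succ'\in\mathcal L(A)^{N'}$ with $N\cap N'=\emptyset$, $\succ\cup\succ'$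 is the profile on $N\cup N'$ agreeing with each of them on its electorate. $1$-clone extension. Let $x\in A$ and $x'\in\mathcal A\setminus A$. A $1$-clone extension of $x$ at $\succ\in\mathcal L(A)^N$ is a profile $\widetilde\succ\in\mathcal L(A\cup\{x'\})^N$ such that $\widetilde\succ|_A=\succ$, $|r_i(x,\widetilde\succ)-r_i(x',\widetilde\succ)|=1$ for every $i\in N$, and $x\,\widetilde\succ_i\,x'$ for every $i\in N$ (i.e. every voter ranks $x'$ immediately below $x$). Axioms (each required whenever all alternative sets involved have at most $\bar m$ elements). - Anonymity: $F(\pi\succ)=F(\succ)$ for every profile $\succ$ and every bijection $\pi:N\to N'$. - Neutrality: $F(\sigma\succ)=\sigma(F(\succ))$ for every profile $\succ$ and every permutation $\sigma:A\to A$. - Consistency: for profiles $\succ,\succ'$ on the same alternative set and disjoint electorates, if $F(\succ)\cap F(\succ')\neq\emptyset$ then $F(\succ\cup\succ')=F(\succ)\cap F(\succ')$. - $1$-Clone Invariance: $F(\widetilde\succ)=F(\succ)$ for every profile $\succ$, every $x\in A$, and every $1$-clone extension $\widetilde\succ$ of $x$ at $\succ$. *)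

(* Defs.v *)
From mathcomp Require Import all_boot all_order all_algebra finmap.
From mathcomp Require Import boolp classical_sets functions cardinality.

Set Implicit Arguments.
Unset Strict Implicit.
Unset Printing Implicit Defensive.

Local Open Scope fset_scope.

(* [P i a b] reads "voter i strictly prefers a to b".  The relation is kept
   false outside the electorate N and the alternative set A ([pref_supp]), so
   that a value of this type carries exactly the family of strict linear orders
   on A indexed by N, and nothing else. *)
Record profile (V X : choiceType) (N : {fset V}) (A : {fset X}) := Profile {
  pref :> V -> rel X;
  pref_supp : forall i a b, pref i a b -> [&& i \in N, a \in A & b \in A];
  pref_asym : forall i a b, pref i a b -> ~~ pref i b a;
  pref_trans : forall i, transitive (pref i);
  pref_complete : forall i a b, i \in N -> a \in A -> b \in A -> a != b ->
    pref i a b || pref i b a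
}.

Definition rank (V X : choiceType) (N : {fset V}) (A : {fset X})
    (P : profile N A) (i : V) (a : X) : nat :=
  (1 + #|` [fset b in A | P i b a]|)%N.

Definition admissible (V X : choiceType) (mbar : nat)
    (N : {fset V}) (A : {fset X}) : bool :=
  [&& N != fset0, A != fset0 & #|` A| <= mbar].

(* [choice] is a total function, but nothing is assumed about it, here or in
   the axioms below, outside the admissible pairs (N, A). *)
Record social_choice_rule (V X : choiceType) (mbar : nat) := SocialChoiceRule {
  choice :> forall (N : {fset V}) (A : {fset X}), profile N A -> {fset X};
  choice_neq0 : forall (N : {fset V}) (A : {fset X}) (P : profile N A),
    admissible mbar N A -> choice P != fset0;
  choice_sub : forall (N : {fset V}) (A : {fset X}) (P : profile N A),
    admissible mbar N A -> choice P `<=` A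
}.

(* A bijection N -> N' is given by a function on V of which only the
   restriction to N matters; likewise for permutations of A. The transformed
   profiles are described by the equations that determine them uniquely. *)
Definition is_relabelling (V X : choiceType) (N N' : {fset V}) (A : {fset X})
    (pi : V -> V) (P : profile N A) (Q : profile N' A) : Prop :=
  forall i a b, i \in N -> a \in A -> b \in A -> Q (pi i) a b = P i a b.

Definition is_renaming (V X : choiceType) (N : {fset V}) (A : {fset X})
    (sigma : X -> X) (P Q : profile N A) : Prop :=
  forall i a b, i \in N -> a \in A -> b \in A ->
    Q i (sigma a) (sigma b) = P i a b.

Definition is_union (V X : choiceType) (N N' : {fset V}) (A : {fset X})
    (P : profile N A) (P' : profile N' A) (Q : profile (N `|` N') A) : Prop :=
  (forall i a b, i \in N -> a \in A -> b \in A -> Q i a b = P i a b) /\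
  (forall i a b, i \in N' -> a \in A -> b \in A -> Q i a b = P' i a b).

Definition is_restriction (V X : choiceType) (N : {fset V}) (A B : {fset X})
    (Q : profile N A) (P : profile N B) : Prop :=
  B `<=` A /\
  forall i a b, i \in N -> a \in B -> b \in B -> P i a b = Q i a b.

Definition is_1clone_extension (V X : choiceType) (N : {fset V}) (A : {fset X})
    (x x' : X) (P : profile N A) (Q : profile N (x' |` A)) : Prop :=
  [/\ is_restriction Q P,
      (forall i, i \in N ->
         `|(rank Q i x)%:Z - (rank Q i x')%:Z|%R = 1%R) &
      (forall i, i \in N -> Q i x x')].

Definition anonymity (V X : choiceType) (mbar : nat)
    (F : social_choice_rule V X mbar) : Prop :=
  forall (N N' : {fset V}) (A : {fset X}) (pi : V -> V)
         (P : profile N A) (Q : profile N' A),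
    admissible mbar N A -> admissible mbar N' A ->
    set_bij [set` N] [set` N'] pi -> is_relabelling pi P Q ->
    F N' A Q = F N A P.

Definition neutrality (V X : choiceType) (mbar : nat)
    (F : social_choice_rule V X mbar) : Prop :=
  forall (N : {fset V}) (A : {fset X}) (sigma : X -> X) (P Q : profile N A),
    admissible mbar N A ->
    set_bij [set` A] [set` A] sigma -> is_renaming sigma P Q ->
    F N A Q = [fset sigma a | a in F N A P].

Definition consistency (V X : choiceType) (mbar : nat)
    (F : social_choice_rule V X mbar) : Prop :=
  forall (N N' : {fset V}) (A : {fset X})
         (P : profile N A) (P' : profile N' A) (Q : profile (N `|` N') A),
    admissible mbar N A -> admissible mbar N' A ->
    [disjoint N & N']%fset -> is_union P P' Q ->
    F N A P `&` F N' A P' != fset0 ->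
    F (N `|` N') A Q = F N A P `&` F N' A P'.

Definition one_clone_invariance (V X : choiceType) (mbar : nat)
    (F : social_choice_rule V X mbar) : Prop :=
  forall (N : {fset V}) (A : {fset X}) (x x' : X)
         (P : profile N A) (Q : profile N (x' |` A)),
    admissible mbar N A -> admissible mbar N (x' |` A) ->
    x \in A -> x' \notin A -> is_1clone_extension x P Q ->
    F N (x' |` A) Q = F N A P.

Definition plurality_score (V X : choiceType) (N : {fset V}) (A : {fset X})
    (P : profile N A) (a : X) : nat :=
  #|` [fset i in N | rank P i a == 1%N]|.

Definition plurality (V X : choiceType) (N : {fset V}) (A : {fset X})
    (P : profile N A) : {fset X} :=
  [fset a in A |
    [forall b : A, plurality_score P (val b) <= plurality_score P a]].

Definition is_plurality (V X : choiceType) (mbar : nat)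
    (F : social_choice_rule V X mbar) : Prop :=
  forall (N : {fset V}) (A : {fset X}) (P : profile N A),
    admissible mbar N A -> F N A P = plurality P.

(* Main.v *)
Require Import Defs.
From mathcomp Require Import all_boot all_order all_algebra finmap.
From mathcomp Require Import boolp classical_sets functions cardinality.
From mathcomp Require Import zify.

(** By anonymity the rule is a function of the list of rankings cast.  For
    rankings r, r' with the same top that differ by swapping adjacent x and y,
    consider the formal profile "r - r'", realised by adding one copy of every
    ranking, which is a complete tie.  Swapping x and y sends it to its opposite,
    so consistency forces it to be a complete tie or to elect x alone or y
    alone.  The latter two are excluded by adding it to a two-voter profile that
    contains r' and a ranking with top x (or y), in which some pair of clones
    allows induction on the number of alternatives.  Hence only tops matter.  If
    some alternative is never on top, it may then be moved right below another
    one and removed as a clone; otherwise one ballot per alternative forms a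
    tie, which consistency allows us to discard. *)

Set Implicit Arguments.
Unset Strict Implicit.
Unset Printing Implicit Defensive.

Local Open Scope fset_scope.

(** * Transpositions of alternatives acting on rankings *)

Section Transposition.
Variable X : choiceType.
Implicit Types (A : {fset X}) (r : seq X).

Definition transp (a b x : X) : X :=
  if x == a then b else if x == b then a else x.

Lemma transpL a b : transp a b a = b.
Proof. by rewrite /transp eqxx. Qed.

Lemma transpR a b : transp a b b = a.
Proof. by rewrite /transp eqxx; case: eqP. Qed.

Lemma transpD a b x : x != a -> x != b -> transp a b x = x.
Proof. by rewrite /transp => /negPf -> /negPf ->. Qed.

Lemma transpK a b : involutive (transp a b).
Proof.
move=> x; have [->|xa] := eqVneq x a; first by rewrite transpL transpR.
have [->|xb] := eqVneq x b; first by rewrite transpR transpL.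
by rewrite !transpD.
Qed.

Lemma transp_inj a b : injective (transp a b).
Proof. exact: inv_inj (@transpK a b). Qed.

Lemma transp_mem A a b x : a \in A -> b \in A -> (transp a b x \in A) = (x \in A).
Proof.
move=> aA bA; have [->|xa] := eqVneq x a; first by rewrite transpL aA bA.
have [->|xb] := eqVneq x b; first by rewrite transpR aA bA.
by rewrite transpD.
Qed.

Lemma map_transpK a b : involutive (map (transp a b)).
Proof. exact: (mapK (@transpK a b)). Qed.

Lemma perm_map_transp A a b r : a \in A -> b \in A ->
  perm_eq r A -> perm_eq (map (transp a b) r) A.
Proof.
move=> aA bA rA; apply: uniq_perm; rewrite ?fset_uniq //.
  by rewrite (map_inj_uniq (@transp_inj a b)) (perm_uniq rA) fset_uniq.
move=> x; rewrite -{1}(transpK a b x) (mem_map (@transp_inj a b)).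
by rewrite (perm_mem rA) transp_mem.
Qed.

Lemma map_transp_id x y r : x \notin r -> y \notin r -> map (transp x y) r = r.
Proof.
move=> xr yr; apply: map_id_in => z zr; apply: transpD; apply/eqP => zE.
  by rewrite -zE zr in xr.
by rewrite -zE zr in yr.
Qed.

Lemma map_transp_adjacent x y p w : uniq (p ++ [:: x, y & w]) ->
  map (transp x y) (p ++ [:: x, y & w]) = p ++ [:: y, x & w].
Proof.
rewrite cat_uniq /= !inE !negb_or -!andbA => /and4P[_ xp yp].
case/and5P=> _ _ xw yw _.
by rewrite map_cat /= transpL transpR !map_transp_id.
Qed.

Lemma perm_fset1U A (z : X) : z \in A -> perm_eq (A `\ z) (rem z A).
Proof.
move=> zA; apply: uniq_perm; rewrite ?rem_uniq ?fset_uniq // => x.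
by rewrite mem_rem_uniq ?fset_uniq // !inE.
Qed.

Lemma map_fset_neq0 (T : eqType) (k : X -> T) A :
  A != fset0 -> map k A != [::].
Proof. by rewrite -size_eq0 size_map -[size _]/(#|` A|) cardfs_eq0. Qed.

End Transposition.

(** * Plurality winners of a list of rankings *)

Section Tops.
Variable X : choiceType.
Implicit Types (A : {fset X}) (L : seq (seq X)) (r : seq X).

Definition rankings A L := all (fun r => perm_eq r A) L.

Definition tops a L := count (fun r => ohead r == Some a) L.

Definition winners A L : {fset X} :=
  [fset a in A | all (fun b => tops b L <= tops a L) A].

Lemma winnersP A L a :
  reflect (a \in A /\ forall b, b \in A -> tops b L <= tops a L)
          (a \in winners A L).
Proof. by rewrite !inE; apply: (iffP andP) => -[? /allP]. Qed.

Lemma winners_pair A r1 r2 a b : a \in A -> b \in A -> a != b ->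
  ohead r1 = Some a -> ohead r2 = Some b ->
  winners A [:: r1; r2] = [fset a; b].
Proof.
move=> aA bA ab h1 h2; have tE c : tops c [:: r1; r2] = ((a == c) + (b == c))%N.
  by rewrite /tops /= h1 h2 addn0.
have ba : (b == a) = false by rewrite eq_sym (negPf ab).
apply/fsetP => c; rewrite in_fset2; apply/winnersP/orP.
  case=> _ /(_ a aA); rewrite !tE eqxx ba (eq_sym a) (eq_sym b).
  by case: (c == a); case: (c == b) => // _; [left|left|right].
case=> /eqP ->; split=> // d dA; rewrite !tE !eqxx ?ba ?(negPf ab).
  by case: (eqVneq a d) => [<-|_]; rewrite ?ba //; case: (b == d).
by case: (eqVneq b d) => [<-|_]; rewrite ?(negPf ab) //; case: (a == d).
Qed.

Lemma tops_map (I : Type) (f g : I -> seq X) s a :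
  (forall i, ohead (f i) = ohead (g i)) -> tops a (map f s) = tops a (map g s).
Proof. by move=> h; rewrite /tops !count_map; apply: eq_count => i /=; rewrite h. Qed.

Lemma eq_winners A L L' : (forall a, a \in A -> tops a L = tops a L') ->
  winners A L = winners A L'.
Proof.
move=> h; apply/fsetP => a; apply/winnersP/winnersP => -[aA m]; split=> // b bA.
  by rewrite -!h ?m.
by rewrite !h ?m.
Qed.

End Tops.

(** The axioms read on lists of ballots. [br_perm] stands for anonymity, [br_transp] for neutrality
    under transpositions, [br_cat] for consistency, with no disjointness to check since ballots
    carry no voters' names, and [br_clone] for clone invariance read downwards, from the larger
    agenda to the smaller. *)
Record ballot_rule (X : choiceType) (mbar : nat)
    (G : {fset X} -> seq (seq X) -> {fset X}) : Prop := BallotRule {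
  br_neq0 : forall A L, A != fset0 -> #|` A| <= mbar -> L != [::] ->
    rankings A L -> G A L != fset0;
  br_sub : forall A L, A != fset0 -> #|` A| <= mbar -> L != [::] ->
    rankings A L -> G A L `<=` A;
  br_perm : forall A L L', A != fset0 -> #|` A| <= mbar -> L != [::] ->
    rankings A L -> perm_eq L L' -> G A L = G A L';
  br_transp : forall A L a b, A != fset0 -> #|` A| <= mbar -> L != [::] ->
    rankings A L -> a \in A -> b \in A ->
    G A (map (map (transp a b)) L) = [fset transp a b x | x in G A L];
  br_cat : forall A L L', A != fset0 -> #|` A| <= mbar ->
    L != [::] -> L' != [::] -> rankings A L -> rankings A L' ->
    G A L `&` G A L' != fset0 -> G A (L ++ L') = G A L `&` G A L';
  br_clone : forall A L d z, A != fset0 -> #|` A| <= mbar -> L != [::] ->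
    rankings A L -> d \in A -> z \in A -> d != z ->
    all (infix [:: d; z]) L -> G A L = G (A `\ z) (map (rem z) L)
}.

(** * Ballot rules: clones, complete ties and swap tests *)

Section BallotRuleTheory.
Variables (X : choiceType) (mbar : nat).
Variable G : {fset X} -> seq (seq X) -> {fset X}.
Hypothesis GP : ballot_rule mbar G.
Implicit Types (L : seq (seq X)) (r : seq X).

Definition plurality_on (A : {fset X}) :=
  A != fset0 -> forall L, L != [::] -> rankings A L -> G A L = winners A L.

Lemma rankings_clone (A : {fset X}) L z : z \in A -> rankings A L ->
  rankings (A `\ z) (map (rem z) L).
Proof.
move=> zA /allP LA; apply/allP => _ /mapP[r /LA rA ->].
rewrite perm_sym (permPl (perm_fset1U zA)) perm_sym.
by rewrite !rem_filter ?(perm_uniq rA) ?fset_uniq // perm_filter.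
Qed.

(** Sitting right below [d] in every ballot, [z] is never on top, and deleting it changes no other
    alternative's number of tops. *)
Lemma clone_winners (A : {fset X}) L d z : A != fset0 -> #|` A| <= mbar -> L != [::] ->
  rankings A L -> d \in A -> z \in A -> d != z -> all (infix [:: d; z]) L ->
  plurality_on (A `\ z) -> G A L = winners A L.
Proof.
move=> A0 Am L0 LA dA zA dz LC IH; rewrite (br_clone GP A0 Am L0 LA dA zA dz LC).
rewrite IH ?rankings_clone //; first last.
- by case: (L) L0.
- by apply/fset0Pn; exists d; rewrite !inE dz.
have topz r : r \in L -> ohead r != Some z.
  move=> rL; have /infixP[p [q rE]] := allP LC _ rL.
  have := allP LA _ rL; move/perm_uniq; rewrite fset_uniq rE.
  case: p {rE} => [|c p] /=; first by move=> _; apply: contra dz => /eqP[->].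
  by rewrite mem_cat !inE !negb_or => /andP[/and4P[_ _ h _] _]; apply: contra h => /eqP[->].
have z0 : tops z L = 0.
  by apply/eqP; rewrite -leqn0 leqNgt -has_count; apply/hasPn => r /topz.
have tE c : c != z -> tops c (map (rem z) L) = tops c L.
  move=> cz; rewrite /tops count_map; apply: eq_in_count => r /topz /=.
  case: r => [//|e r] /=; case: (eqVneq e z) => [->|//].
  by rewrite eqxx.
(* Some alternative has a positive score, so [z], whose score is 0, is no winner. *)
have [c cA c0] : exists2 c, c \in A & 0 < tops c L.
  case: (L) L0 LA => [//|r L'] _ /= /andP[rA _].
  case: r rA => [|c r] rA.
    by have := perm_mem rA d; rewrite dA.
  exists c; last by rewrite /= eqxx.
  by rewrite -(perm_mem rA) mem_head.
apply/fsetP => a; apply/winnersP/winnersP.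
  rewrite !inE => -[/andP[az aA] m]; split=> // b bA.
  have [->|bz] := eqVneq b z; first by rewrite z0.
  by rewrite -!tE // m // !inE bz.
case=> aA m; have az : a != z.
  by apply/eqP => az; have := m _ cA; rewrite az z0 leqNgt c0.
rewrite !inE az; split=> // b; rewrite !inE => /andP[bz bA].
by rewrite !tE // m.
Qed.

Section FixedAgenda.
Variable A : {fset X}.
Hypotheses (A0 : A != fset0) (Am : #|` A| <= mbar).

Lemma mem_choice_transp L a b z : L != [::] -> rankings A L ->
  a \in A -> b \in A ->
  (z \in G A (map (map (transp a b)) L)) = (transp a b z \in G A L).
Proof.
move=> L0 LA aA bA; rewrite (br_transp GP) //.
by rewrite -{1}(transpK a b z) mem_imfset //; apply: transp_inj.
Qed.

(** The choice contains some [z]; exchanging [z] with an arbitrary [y] puts [y] into it too. *)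
Lemma symmetric_tie L : L != [::] -> rankings A L ->
  (forall a b, a \in A -> b \in A -> G A (map (map (transp a b)) L) = G A L) ->
  G A L = A.
Proof.
move=> L0 LA sym; have GA := fsubsetP (br_sub GP A0 Am L0 LA).
have /fset0Pn[z zG] := br_neq0 GP A0 Am L0 LA.
apply/fsetP => y; apply/idP/idP => [/GA //|yA].
by have zA := GA _ zG; rewrite -(sym y z yA zA) mem_choice_transp // transpL.
Qed.

Let T0 := permutations A.

Lemma all_rankings_neq0 : T0 != [::].
Proof.
have : enum_fset A \in T0 by rewrite mem_permutations.
by case: T0.
Qed.

Lemma rankings_all : rankings A T0.
Proof. by apply/allP => r; rewrite mem_permutations. Qed.

Lemma transp_all_rankings a b : a \in A -> b \in A ->
  perm_eq (map (map (transp a b)) T0) T0.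
Proof.
have inj := inv_inj (@map_transpK _ a b).
move=> aA bA; apply: uniq_perm; rewrite ?(map_inj_uniq inj) ?permutations_uniq //.
move=> r; rewrite -{1}(map_transpK a b r) (mem_map inj) !mem_permutations.
apply/idP/idP; last exact: perm_map_transp.
by rewrite -{2}(map_transpK a b r); apply: perm_map_transp.
Qed.

Lemma rankings_transp L a b : a \in A -> b \in A -> rankings A L ->
  rankings A (map (map (transp a b)) L).
Proof.
move=> aA bA /allP LA; apply/allP => _ /mapP[r /LA rA ->].
exact: perm_map_transp.
Qed.

(** A transposition merely permutes the list of all rankings. *)
Lemma all_rankings_tie : G A T0 = A.
Proof.
apply: symmetric_tie; [exact: all_rankings_neq0|exact: rankings_all|] => a b aA bA.
apply: (br_perm GP) => //; last exact: transp_all_rankings.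
  by have := all_rankings_neq0; case: T0.
exact: rankings_transp rankings_all.
Qed.

(* [swap_test x y r] stands for the formal difference r - r', where r' is r with
   x and y exchanged: all rankings together tie, so adding them to a profile
   has no effect. *)
Definition swap_test x y r := r :: rem (map (transp x y) r) T0.

Lemma rankings_swap_test x y r : perm_eq r A -> rankings A (swap_test x y r).
Proof.
move=> rA; rewrite /= rA /=; apply/allP => s /mem_rem.
by rewrite mem_permutations.
Qed.

(** The list and its image under the swap together make two copies of all rankings, hence a complete
    tie. If their two choices meet, consistency forces the choice to be all of [A]; if they are
    disjoint, exactly one of [x] and [y] is elected, and nothing else. *)
Lemma swap_test_dichotomy x y r : x \in A -> y \in A -> x != y ->
  perm_eq r A ->
  G A (swap_test x y r) = A \/
  exists2 e, e \in [:: x; y] & G A (swap_test x y r) = [fset e].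
Proof.
move=> xA yA xy rA; set V := swap_test x y r.
have VA : rankings A V by exact: rankings_swap_test.
set V' := map (map (transp x y)) V.
have V'A : rankings A V' by exact: rankings_transp.
have mV' z : (z \in G A V') = (transp x y z \in G A V).
  by rewrite mem_choice_transp.
have GVA := fsubsetP (br_sub GP A0 Am (isT : V != [::]) VA).
have r'T : map (transp x y) r \in T0.
  by rewrite mem_permutations perm_map_transp.
(* As multisets, [V] is [T0] with the swapped ranking traded for [r], and [V'] is [T0] with the
   reverse trade. *)
have VV' : perm_eq (T0 ++ T0) (V ++ V').
  have p1 := perm_to_rem r'T.
  have p2 : perm_eq T0 (r :: map (map (transp x y)) (rem (map (transp x y) r) T0)).
    rewrite -(permPl (transp_all_rankings xA yA)).
    by rewrite (permPl (perm_map _ p1)) /= map_transpK.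
  rewrite (permPl (perm_cat p2 p1)).
  rewrite /V' /V /swap_test /=.
  by apply/permP => q; rewrite /= !count_cat /=; clear; lia.
have GVV' : G A (V ++ V') = A.
  have T00 := all_rankings_neq0; have TA := rankings_all.
  rewrite -(br_perm GP A0 Am _ _ VV'); first last.
  - by rewrite /rankings all_cat; apply/andP.
  - by case: (T0) T00.
  rewrite (br_cat GP) ?all_rankings_tie ?fsetIid //.
have [I0|I0] := boolP (G A V `&` G A V' == fset0); last first.
  left; apply/fsetP => z; apply/idP/idP => [/GVA //|].
  rewrite -{1}GVV' (br_cat GP) //; first by rewrite in_fsetI => /andP[].
(* No elected alternative has its image under the swap elected. This excludes the fixed points of
   the swap, and also [x] and [y] together. *)
right; have disj z : z \in G A V -> transp x y z \notin G A V.
  move=> zV; apply/negP => tV; move/eqP/fsetP/(_ z): I0.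
  by rewrite in_fsetI zV mV' tV inE.
have sub z : z \in G A V -> z \in [:: x; y].
  move=> zV; rewrite !inE; apply/negPn/negP; rewrite negb_or => /andP[zx zy].
  by have := disj _ zV; rewrite transpD ?zV.
have /fset0Pn[e eV] := br_neq0 GP A0 Am (isT : V != [::]) VA.
exists e; first exact: sub.
apply/fsetP => z; rewrite in_fset1; apply/idP/eqP => [zV|-> //].
apply/eqP/negPn/negP => ze; have /negP[] := disj _ zV.
suff -> : transp x y z = e by [].
have := sub _ eV; have := sub _ zV; rewrite !inE => /orP[] /eqP zE /orP[] /eqP eE.
- by rewrite zE eE eqxx in ze.
- by rewrite zE eE transpL.
- by rewrite zE eE transpR.
- by rewrite zE eE eqxx in ze.
Qed.

(** With [r'] the swapped ranking, [(r' :: Z) ++ V] rearranges to [(r :: Z) ++ T0]. Consistency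
    evaluates the first list as the intersection and the second as the choice from [r :: Z], because
    [T0] ties completely. *)
Lemma absorb_swap_test x y r Z : x \in A -> y \in A -> perm_eq r A ->
  rankings A Z ->
  let V := swap_test x y r in
  G A (map (transp x y) r :: Z) `&` G A V != fset0 ->
  G A (r :: Z) = G A (map (transp x y) r :: Z) `&` G A V.
Proof.
move=> xA yA rA ZA V I0; set r' := map _ _ in I0 *.
have r'A : perm_eq r' A by exact: perm_map_transp.
have VA : rankings A V by exact: rankings_swap_test.
have rZA : rankings A (r :: Z) by rewrite /= rA.
have r'ZA : rankings A (r' :: Z) by rewrite /= r'A.
rewrite -(br_cat GP) //.
have T00 := all_rankings_neq0.
have r'T : r' \in T0 by rewrite mem_permutations.
have /(br_perm GP A0 Am _ _) -> // : perm_eq ((r' :: Z) ++ V) ((r :: Z) ++ T0).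
- rewrite perm_sym (permPl (perm_cat (perm_refl _) (perm_to_rem r'T))).
  by rewrite /V /swap_test -/r'; apply/permP => q; rewrite /= !count_cat /=; clear; lia.
- have GA := br_sub GP A0 Am (isT : r :: Z != [::]) rZA.
  rewrite (br_cat GP) ?all_rankings_tie ?(fsetIidPl GA) //.
    exact: rankings_all.
  exact: (br_neq0 GP).
- by rewrite /rankings all_cat; apply/andP.
Qed.

(** * Induction step: only the tops of the ballots matter *)

Hypothesis IH : forall z, z \in A -> plurality_on (A `\ z).

(** Removing the clone [z] leads to the smaller agenda, where the induction hypothesis applies. *)
Lemma choice_clone_pair r1 r2 a b d z : rankings A [:: r1; r2] ->
  a != b -> ohead r1 = Some a -> ohead r2 = Some b ->
  d \in A -> z \in A -> d != z -> infix [:: d; z] r1 -> infix [:: d; z] r2 ->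
  G A [:: r1; r2] = [fset a; b].
Proof.
move=> rA ab h1 h2 dA zA dz i1 i2.
have hA r e : perm_eq r A -> ohead r = Some e -> e \in A.
  by case: r => [//|c r] rA' [<-]; rewrite -(perm_mem rA') mem_head.
have /and3P[r1A r2A _] := rA.
have i12 : all (infix [:: d; z]) [:: r1; r2] by apply/and3P.
rewrite (clone_winners A0 Am _ rA dA zA dz i12 (IH zA)) //.
by apply: winners_pair; [exact: hA h1|exact: hA h2| | |].
Qed.

(** If the test elected [e] alone, with [e] one of [x] and [y], it would break ties in favour of
    [e]: whenever [e] wins with the swapped ballot, it wins alone with [r]. A second ballot [s] with
    top [e] is chosen so that this ousts the top [a] of [r] in a situation where [a] must still win.
    The nonempty prefix [p] provides [a], distinct from [x] and [y]. *)
Lemma swap_test_tie p x y w : p != [::] -> perm_eq (p ++ [:: x, y & w]) A ->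
  G A (swap_test x y (p ++ [:: x, y & w])) = A.
Proof.
move=> p0 rA; set r := p ++ _ in rA *.
have ur : uniq r by rewrite (perm_uniq rA) fset_uniq.
have rE : map (transp x y) r = p ++ [:: y, x & w] by exact: map_transp_adjacent.
have inA c : c \in r -> c \in A by rewrite (perm_mem rA).
have xA : x \in A by rewrite inA // mem_cat !inE eqxx orbT.
have yA : y \in A by rewrite inA // mem_cat !inE eqxx !orbT.
have xy : x != y.
  by move: ur; rewrite cat_uniq /= !inE !negb_or -!andbA => /and5P[_ _ _ _ /andP[]].
have [//|[e exy GV]] := swap_test_dichotomy xA yA xy rA.
have eA : e \in A by move: exy; rewrite !inE => /orP[] /eqP ->.
have key Z : rankings A Z -> e \in G A ((p ++ [:: y, x & w]) :: Z) ->
    G A (r :: Z) = [fset e].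
  move=> ZA eG; have IE : G A (map (transp x y) r :: Z) `&` G A (swap_test x y r)
      = [fset e].
    by rewrite rE GV; apply/fsetIidPr; rewrite fsub1set.
  rewrite (absorb_swap_test xA yA rA ZA) IE //.
  by apply/fset0Pn; exists e; rewrite in_fset1.
have [a [u pE]] : exists a u, p = a :: u by case: (p) p0 => // a u; exists a, u.
have ra : a \in A by rewrite inA // /r pE mem_head.
have perm_to (s : seq X) : perm_eq s r -> perm_eq s A by move/permPl ->.
have r'A : perm_eq (p ++ [:: y, x & w]) A.
  by apply: perm_to; apply/permP => q; rewrite /r !count_cat /=; clear; lia.
have infixI (s t : seq X) c d : infix [:: c; d] (s ++ [:: c, d & t]).
  by apply/infixP; exists s, t.
have [ax ay] : a != x /\ a != y.
  move: ur; rewrite /r pE /= mem_cat !inE !negb_or => /andP[].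
  by case/and4P.
have ae : a != e by move: exy; rewrite !inE => /orP[] /eqP ->.
have pairF s : perm_eq s A -> G A [:: r; s] = [fset e] ->
    a \in G A [:: r; s] -> False.
  by move=> _ ->; rewrite in_fset1 (negPf ae).
(* If [p] is [a] alone, take for [s] the ballot [r] with [a] and [e] exchanged: [[:: r; s]] is
   symmetric under this exchange, so electing [e] entails electing [a]. *)
case: u pE => [|b u] pE.
  have r'A1 := r'A; rewrite pE /= in r'A1.
  have contra_sym s : perm_eq s A -> map (transp a e) r = s ->
      e \in G A [:: p ++ [:: y, x & w]; s] -> False.
    move=> sA sE /key; rewrite /= sA => /(_ isT) GE; apply: (pairF _ sA GE).
    have rsA : rankings A [:: r; s] by rewrite /= rA sA.
    have sym : perm_eq (map (map (transp a e)) [:: r; s]) [:: r; s].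
      by rewrite /= -sE map_transpK sE; apply/permP => q /=; clear; lia.
    rewrite -(br_perm GP A0 Am _ _ sym) //; last exact: rankings_transp.
    by rewrite mem_choice_transp // transpL GE in_fset1.
  have uw : [/\ a \notin w, x \notin w & y \notin w].
    move: ur; rewrite /r pE /= !inE !negb_or => /and4P[/and3P[_ _ ->]].
    by case/andP => _ -> ->.
  have [aw xw yw] := uw.
  move: exy; rewrite !inE => /orP[] /eqP eE.
  (* For [e = x], the swapped ballot [a y x w] and [s = x a y w] share the clone pair [a], [y]. *)
  - case: (contra_sym [:: x, a, y & w]).
    + by apply: perm_to; apply/permP => q; rewrite /r pE /=; clear; lia.
    + rewrite /r pE eE /= transpL transpR transpD // 1?eq_sym //.
      by rewrite map_transp_id.
    + rewrite (@choice_clone_pair _ _ a x a y) ?pE ?eE //.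
      * by rewrite !inE eqxx orbT.
      * rewrite /= r'A1 /= andbT.
        by apply: perm_to; apply/permP => q; rewrite /r pE /=; clear; lia.
      * exact: (infixI [::]).
      * exact: (infixI [:: x]).
  (* For [e = y], the swapped ballot [a y x w] and [s = y x a w] share the clone pair [y], [x]. *)
  - case: (contra_sym [:: y, x, a & w]).
    + by apply: perm_to; apply/permP => q; rewrite /r pE /=; clear; lia.
    + rewrite /r pE eE /= transpL transpR transpD // 1?eq_sym //.
      by rewrite map_transp_id.
    + rewrite (@choice_clone_pair _ _ a y y x) ?pE ?eE //.
      * by rewrite !inE eqxx orbT.
      * rewrite /= r'A1 /= andbT.
        by apply: perm_to; apply/permP => q; rewrite /r pE /=; clear; lia.
      * by rewrite eq_sym.
      * exact: (infixI [::]).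
have rb : b \in A by rewrite inA // /r pE !inE eqxx orbT.
have ab : a != b.
  by move: ur; rewrite /r pE /= !inE negb_or => /andP[/andP[]].
(* Here [s] is [r] with [e] moved to the front. The first two entries [a], [b] of [p] stay adjacent
   in [r], in the swapped ballot and in [s], so [[:: r; s]] must elect [a] as well as [e]. *)
pose s := e :: (a :: b :: u) ++ (if e == x then y else x) :: w.
have sA : perm_eq s A.
  apply: perm_to; apply/permP => q; rewrite /r /s pE /= !count_cat /=.
  move: exy; rewrite !inE; case: eqVneq => [-> _|_ /= /eqP ->] /=; clear; lia.
have [i i' i''] : [/\ infix [:: a; b] r, infix [:: a; b] (p ++ [:: y, x & w])
    & infix [:: a; b] s].
  by rewrite /r /s pE; split; [exact: (infixI [::])|exact: (infixI [::])
    |exact: (infixI [:: e])].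
have GE : G A [:: r; s] = [fset e].
  apply: key; first by rewrite /= sA.
  rewrite (@choice_clone_pair _ _ a e a b) ?pE //.
  - by rewrite !inE eqxx orbT.
  - by rewrite -pE /= r'A sA.
  - by rewrite -pE.
case: (pairF s sA GE).
rewrite (@choice_clone_pair _ _ a e a b) //.
- by rewrite !inE eqxx.
- by rewrite /= rA sA.
- by rewrite /r pE.
Qed.

(** The swap test is now known to tie completely, so absorbing it does not alter the choice. *)
Lemma choice_swap p x y w Z : p != [::] -> perm_eq (p ++ [:: x, y & w]) A ->
  rankings A Z ->
  G A ((p ++ [:: x, y & w]) :: Z) = G A ((p ++ [:: y, x & w]) :: Z).
Proof.
move=> p0 rA ZA; have ur : uniq (p ++ [:: x, y & w]).
  by rewrite (perm_uniq rA) fset_uniq.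
have xA : x \in A by rewrite -(perm_mem rA) mem_cat !inE eqxx orbT.
have yA : y \in A by rewrite -(perm_mem rA) mem_cat !inE eqxx !orbT.
have := absorb_swap_test xA yA rA ZA.
rewrite /= swap_test_tie // map_transp_adjacent //.
have r'ZA : rankings A ((p ++ [:: y, x & w]) :: Z).
  by rewrite /= -map_transp_adjacent // perm_map_transp.
rewrite (fsetIidPl (br_sub GP A0 Am _ r'ZA)) // => -> //.
exact: (br_neq0 GP).
Qed.

Lemma choice_bubble p t1 c t2 Z : p != [::] ->
  perm_eq (p ++ t1 ++ c :: t2) A -> rankings A Z ->
  G A ((p ++ t1 ++ c :: t2) :: Z) = G A ((p ++ c :: t1 ++ t2) :: Z).
Proof.
elim: t1 p => [//|b t1 IHt] p p0 rA ZA.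
have := IHt (rcons p b); rewrite !cat_rcons => -> //; last by case: (p).
apply: choice_swap => //; apply: perm_trans rA.
by apply/permP => q; rewrite /= !count_cat /= !count_cat /=; clear; lia.
Qed.

Lemma choice_perm_tail p t t' Z : p != [::] -> perm_eq t t' ->
  perm_eq (p ++ t) A -> rankings A Z ->
  G A ((p ++ t) :: Z) = G A ((p ++ t') :: Z).
Proof.
elim: t' p t => [|c t' IHt] p t p0 tt' rA ZA.
  by rewrite (perm_nilP tt').
have ct : c \in t by rewrite (perm_mem tt') mem_head.
case/splitPr: ct tt' rA => t1 t2 tt' rA.
rewrite choice_bubble // -!cat_rcons; apply: IHt => //; first by case: (p).
  rewrite -(perm_cons c) -(permPr tt').
  by apply/permP => q; rewrite /= !count_cat /=; clear; lia.
apply: perm_trans rA; apply/permP => q; rewrite !cat_rcons /= !count_cat /= !count_cat /=; clear; lia.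
Qed.

Lemma choice_same_top r r' Z : perm_eq r A -> perm_eq r' A ->
  ohead r = ohead r' -> rankings A Z -> G A (r :: Z) = G A (r' :: Z).
Proof.
case: r r' => [|a t] [|b t'] //= rA r'A [ab] ZA; subst b.
apply: (@choice_perm_tail [:: a]) => //.
by rewrite -(perm_cons a) (permPl rA) perm_sym.
Qed.

(** Ballots are replaced one at a time, and [Z] receives those already replaced. *)
Lemma choice_map_same_top (I : eqType) (f g : I -> seq X) s Z :
  map f s ++ Z != [::] -> rankings A Z ->
  (forall i, i \in s -> [/\ perm_eq (f i) A, perm_eq (g i) A
                          & ohead (f i) = ohead (g i)]) ->
  G A (map f s ++ Z) = G A (map g s ++ Z).
Proof.
elim: s Z => [//|i s IHs] Z _ ZA h.
have [fA gA fg] := h i (mem_head _ _).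
have h' j : j \in s -> [/\ perm_eq (f j) A, perm_eq (g j) A
                         & ohead (f j) = ohead (g j)].
  by move=> js; apply: h; rewrite inE js orbT.
have fsA : rankings A (map f s ++ Z).
  by rewrite /rankings all_cat -/(rankings A Z) ZA andbT; apply/allP => _ /mapP[j /h'[? _ _] ->].
have gsA : rankings A (map g s ++ g i :: Z).
  by rewrite /rankings all_cat /= gA -/(rankings A Z) ZA !andbT; apply/allP => _ /mapP[j /h'[_ ? _] ->].
have mid (k : I -> seq X) : perm_eq (map k s ++ g i :: Z) (g i :: map k s ++ Z).
  by apply/permP => q; rewrite /= !count_cat /=; clear; lia.
rewrite /= (choice_same_top fA gA fg fsA).
rewrite -(br_perm GP A0 Am _ _ (mid g)) //; last by case: (map g s).
rewrite -IHs //; last by rewrite /= gA.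
  apply: (br_perm GP) => //; first by rewrite /= gA.
  by rewrite perm_sym mid.
by case: (map f s).
Qed.

(** * Induction step: profiles with one canonical ballot per top *)

Definition toplist a := a :: rem a A.

Lemma toplist_perm a : a \in A -> perm_eq (toplist a) A.
Proof. by move=> aA; rewrite perm_sym perm_to_rem. Qed.

Lemma rankings_toplist H : all (mem A) H -> rankings A (map toplist H).
Proof.
by move=> /allP HA; apply/allP => _ /mapP[a /HA aA ->]; apply: toplist_perm.
Qed.

Lemma tops_toplist b H : tops b (map toplist H) = count_mem b H.
Proof. by rewrite /tops count_map; apply: eq_count. Qed.

(** A transposition permutes the tops, so up to the order below the tops it only permutes these
    ballots. *)
Lemma choice_toplist_full : G A (map toplist A) = A.
Proof.
have nz (k : X -> seq X) : map k A != [::].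
  exact: map_fset_neq0.
have AA : rankings A (map toplist A) by apply: rankings_toplist; apply/allP.
apply: symmetric_tie => // a b aA bA.
rewrite -map_comp -[LHS]/(G A (map (map (transp a b) \o toplist) A)).
have h c : c \in enum_fset A ->
    [/\ perm_eq ((map (transp a b) \o toplist) c) A,
        perm_eq ((toplist \o transp a b) c) A &
        ohead ((map (transp a b) \o toplist) c) = ohead ((toplist \o transp a b) c)].
  move=> cA; split=> //.
    exact: perm_map_transp (toplist_perm cA).
  by apply: toplist_perm; rewrite transp_mem.
rewrite -[X in G A X]cats0 (choice_map_same_top _ _ h) ?cats0 //.
apply: (br_perm GP) => //.
  by apply/allP => _ /mapP[c /h[_ ? _] ->].
rewrite map_comp; apply: perm_map; apply: uniq_perm; rewrite ?fset_uniq //.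
  by rewrite (map_inj_uniq (@transp_inj _ a b)) fset_uniq.
move=> c; rewrite -{1}(transpK a b c) (mem_map (@transp_inj _ a b)).
exact: transp_mem.
Qed.

(** Strong induction on the number of ballots, so that a tie made of several ballots can be
    discarded at once. *)
Lemma choice_toplist H : H != [::] -> all (mem A) H ->
  G A (map toplist H) = winners A (map toplist H).
Proof.
have [n] := ubnP (size H); elim: n H => // n IHn H /ltnSE szH H0 HA.
have HnA := rankings_toplist HA.
have Hn0 : map toplist H != [::] by case: (H) H0.
have [/allP AH|/allPn[z zA zH]] := boolP (all (mem H) A).
  have [s sH As] : exists2 s, subseq s H & perm_eq A s.
    apply/count_subseqP => b; rewrite count_uniq_mem ?fset_uniq //.
    by case: (boolP (b \in _)) => // /AH /=; rewrite -has_pred1 has_count.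
  have [H' HH'] := perm_to_subseq sH.
  have HE : perm_eq H (A ++ H').
    by rewrite (permPl HH') perm_cat2r perm_sym.
  have pE : perm_eq (map toplist H) (map toplist A ++ map toplist H').
    by rewrite -map_cat perm_map.
  (* Splitting off one ballot per alternative lowers every score by one, so the winners stay the
     same. *)
  have tE b : b \in A -> tops b (map toplist H) = (tops b (map toplist H')).+1.
    move=> bA; rewrite !tops_toplist (permP HE) count_cat count_uniq_mem ?fset_uniq //.
    by rewrite bA.
  have wE : winners A (map toplist H) = winners A (map toplist H').
    by apply/fsetP => a; apply/winnersP/winnersP => -[aA m]; split=> // b bA;
      have := m b bA; rewrite !tE.
  have AA : rankings A (map toplist A) by apply: rankings_toplist; apply/allP.
  have An0 : map toplist A != [::].
    exact: map_fset_neq0.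
  rewrite (br_perm GP A0 Am Hn0 HnA pE) wE.
  (* With no ballot left over, all scores are equal and every alternative wins. *)
  have [->|H'0] := eqVneq H' [::].
    rewrite cats0 choice_toplist_full; apply/fsetP => a; apply/idP/winnersP => [aA|[]//].
    by split.
  have H'A : all (mem A) H'.
    by apply/allP => b bH; apply: (allP HA); rewrite (perm_mem HE) mem_cat bH orbT.
  have szH' : size H' < n.
    rewrite (leq_trans _ szH) // (perm_size HE) size_cat.
    by case: (enum_fset A) An0 => //= a l _; rewrite addSn ltnS leq_addl.
  have H'nA := rankings_toplist H'A.
  have H'n0 : map toplist H' != [::] by case: (H') H'0.
  have GH := br_sub GP A0 Am H'n0 H'nA.
  rewrite (br_cat GP) // ?choice_toplist_full ?(fsetIidPr GH) ?IHn //.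
  by rewrite -IHn // (br_neq0 GP).
(* Now [z] is never on top. Any top [d] occurring in [H] differs from [z] and can serve as the
   alternative that [z] is placed below. *)
have [d dH] : exists d, d \in H.
  by case: (H) H0 => // d H' _; exists d; rewrite mem_head.
have dA : d \in A by exact: (allP HA).
have dz : d != z by apply: contra zH => /eqP <-.
(* The top [a] is kept, and the pair [d], [z] is placed as high as this allows; for [a = d] the pair
   heads the ballot. *)
pose c a := if a == d then d :: z :: rem z (rem d A)
            else a :: d :: z :: rem z (rem d (rem a A)).
have h a : a \in H ->
    [/\ perm_eq (toplist a) A, perm_eq (c a) A & ohead (toplist a) = ohead (c a)].
  move=> aH; have aA : a \in A by exact: (allP HA).
  have za : z != a by apply: contra zH => /eqP ->.
  split; first exact: toplist_perm; last by rewrite /c; case: eqVneq => [->|].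
  have uA := fset_uniq A.
  rewrite /c; case: eqVneq => [ad|ad]; rewrite perm_sym.
    rewrite (permPl (perm_to_rem dA)) perm_cons perm_to_rem //.
    by rewrite mem_rem_uniq // !inE eq_sym dz.
  rewrite (permPl (perm_to_rem aA)) perm_cons.
  have dr : d \in rem a A by rewrite mem_rem_uniq // !inE eq_sym ad.
  rewrite (permPl (perm_to_rem dr)) perm_cons perm_to_rem //.
  rewrite mem_rem_uniq ?rem_uniq // !inE eq_sym dz /=.
  by rewrite mem_rem_uniq // !inE za.
rewrite -[X in G A X]cats0 (choice_map_same_top _ _ h) ?cats0 //.
have cA : rankings A (map c H).
  by apply/allP => _ /mapP[a /h[_ ? _] ->].
have cI : all (infix [:: d; z]) (map c H).
  apply/allP => _ /mapP[a _ ->]; rewrite /c; case: eqVneq => _; apply/infixP.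
    by exists [::], (rem z (rem d A)).
  by exists [:: a], (rem z (rem d (rem a A))).
rewrite (clone_winners A0 Am _ cA dA zA dz cI (IH zA)); last by case: (H) H0.
apply: eq_winners => b _; apply: tops_map => a; rewrite /c.
by case: eqVneq => [->|].
Qed.

Lemma choice_winners : plurality_on A.
Proof.
move=> _ L L0 LA.
(* [x0] is the default value of [head]; its membership in [A] also shows that no ballot is empty. *)
have /fset0Pn[x0 x0A] := A0; pose f := head x0.
have h r : r \in L -> [/\ perm_eq (id r) A, perm_eq ((toplist \o f) r) A
                       & ohead (id r) = ohead ((toplist \o f) r)].
  move=> /(allP LA) rA; case: r rA => [|a r] rA.
    by have := perm_mem rA x0; rewrite x0A.
  by split=> //; apply: toplist_perm; rewrite -(perm_mem rA) mem_head.
have GE : G A L = G A (map toplist (map f L)).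
  rewrite -map_comp -{1}(map_id L) -[X in G A X]cats0.
  by rewrite (choice_map_same_top _ _ h) ?cats0 // map_id.
have fA : all (mem A) (map f L).
  apply/allP => _ /mapP[r /h[_ /perm_mem fE _] ->] /=.
  by rewrite -fE mem_head.
rewrite GE choice_toplist //; last by case: (L) L0.
apply: eq_winners => b _; rewrite tops_toplist count_map.
apply: eq_in_count => r /h[_ _ ->] //.
Qed.

End FixedAgenda.

(** Strong induction on the size of the agenda. A singleton needs no separate case: removing its
    element leaves [fset0], where [plurality_on] holds vacuously. *)
Theorem ballot_rule_plurality A : #|` A| <= mbar -> plurality_on A.
Proof.
have [n] := ubnP #|` A|; elim: n A => // n IHn A /ltnSE An Am A0.
apply: choice_winners => // z zA; have := cardfsD1 z A; rewrite zA /= => AE.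
by apply: IHn; lia.
Qed.

End BallotRuleTheory.

(** * Profiles represented by families of lists *)

Section ListedProfiles.
Variables V X : choiceType.
Implicit Types (N : {fset V}) (A : {fset X}) (f : V -> seq X).

Section Construction.
Variables (N : {fset V}) (A : {fset X}) (f : V -> seq X).

(** A list that is no ranking of [A] is replaced by the enumeration of [A], so that every [f] yields
    a profile. *)
Let ord i : seq X := if perm_eq (f i) A then f i else A.

Definition list_pref : V -> rel X := fun i a b =>
  [&& i \in N, a \in A, b \in A & index a (ord i) < index b (ord i)].

Lemma list_pref_supp i a b : list_pref i a b -> [&& i \in N, a \in A & b \in A].
Proof. by case/and4P=> -> -> ->. Qed.

Lemma list_pref_asym i a b : list_pref i a b -> ~~ list_pref i b a.
Proof. by case/and4P=> _ _ _ h; rewrite /list_pref [_ < _]ltnNge ltnW ?andbF. Qed.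

Lemma list_pref_trans i : transitive (list_pref i).
Proof.
move=> b a c /and4P[iN aA _ h] /and4P[_ _ cA h'].
by rewrite /list_pref iN aA cA (ltn_trans h h').
Qed.

Lemma list_pref_complete i a b : i \in N -> a \in A -> b \in A -> a != b ->
  list_pref i a b || list_pref i b a.
Proof.
move=> iN aA bA ab; rewrite /list_pref iN aA bA /= -neq_ltn.
apply: contra ab => /eqP iE; have ordE : ord i =i A.
  by rewrite /ord; case: ifP => // /perm_mem.
by apply/eqP; apply: (index_inj a) iE; rewrite ordE.
Qed.

Definition list_profile : profile N A :=
  Profile list_pref_supp list_pref_asym list_pref_trans list_pref_complete.

End Construction.

(** A relation between profiles and lists, so that profiles are compared through their lists and
    never by equality of records. *)
Definition listed N A (P : profile N A) f := forall i, i \in N ->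
  perm_eq (f i) A /\
  forall a b, a \in A -> b \in A -> P i a b = (index a (f i) < index b (f i)).

Lemma listed_list_profile N A f : (forall i, i \in N -> perm_eq (f i) A) ->
  listed (list_profile N A f) f.
Proof.
move=> fA i iN; split; first exact: fA.
by move=> a b aA bA; rewrite /= /list_pref iN aA bA fA.
Qed.

Lemma listed_exists N A (P : profile N A) : exists f, listed P f.
Proof.
(* Sorting calls for a total relation, hence the reflexive closure. *)
pose le i a b := (a == b) || P i a b.
exists (fun i => sort (le i) A) => i iN.
split; first exact: permEl (perm_sort _ _).
have le_tr : transitive (le i).
  move=> b a c /orP[/eqP -> //|ab] /orP[/eqP <-|bc]; first by rewrite /le ab orbT.
  by rewrite /le (pref_trans ab bc) orbT.
have sS : sorted (le i) (sort (le i) A).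
  apply: (@sort_sorted_in _ (mem A)) => [a b aA bA|]; last exact/allP.
  rewrite /le; case: eqVneq => //= ab.
  by have /orP[->|->] := pref_complete P iN aA bA ab; rewrite ?orbT.
move=> a b aA bA; have ltP c d : c \in A -> d \in A ->
    index c (sort (le i) A) < index d (sort (le i) A) -> P i c d.
  move=> cA dA h; have := sorted_ltn_index le_tr sS; move/(_ c d).
  rewrite !mem_sort => /(_ cA dA h) /orP[/eqP cd|//].
  by rewrite cd ltnn in h.
apply/idP/idP => [ab|]; last exact: ltP.
rewrite ltnNge leq_eqVlt; apply/negP => /orP[/eqP iE|/ltP ba].
  have ba : b = a by apply: (index_inj a) iE; rewrite mem_sort.
  by move: ab (pref_asym ab); rewrite ba => ->.
by have := pref_asym ab; rewrite ba.
Qed.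

(** The alternatives above [a] form the prefix of [f i] that ends just before [a]. *)
Lemma rank_listed N A (P : profile N A) f i a : listed P f -> i \in N ->
  a \in A -> rank P i a = (index a (f i)).+1.
Proof.
move=> Pf iN aA; have [fA PE] := Pf i iN; rewrite /rank add1n; congr _.+1.
have fu : uniq (f i) by rewrite (perm_uniq fA) fset_uniq.
have af : a \in f i by rewrite (perm_mem fA).
rewrite -[RHS](size_takel (index_size a (f i))); apply: perm_size.
apply: uniq_perm; rewrite ?fset_uniq ?take_uniq // => b; rewrite !inE.
have [bA|bA] /= := boolP (b \in A).
  by rewrite in_take ?PE // (perm_mem fA).
by apply/esym/negP => /mem_take; rewrite (perm_mem fA) (negPf bA).
Qed.

(** As a count over the enumeration of [N], the score can be carried along permutations and split
    over unions. *)
Lemma plurality_score_count N A (P : profile N A) a : plurality_score P a =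
  count (fun i => all (fun b => ~~ P i b a) A) N.
Proof.
rewrite /plurality_score -size_filter; apply: perm_size.
apply: uniq_perm; rewrite ?filter_uniq ?fset_uniq // => i.
rewrite !inE mem_filter andbC; congr (_ && _).
rewrite /rank -[X in _ == X]addn0 eqn_add2l cardfs_eq0.
apply/eqP/allP => [E b bA|E]; last first.
  by apply/fsetP => b; rewrite !inE; apply/andP => -[/E/negP].
by apply/negP => Pba; have /fsetP/(_ b) := E; rewrite !inE bA Pba.
Qed.

Lemma pluralityP N A (P : profile N A) a :
  reflect (a \in A /\ forall b, b \in A -> plurality_score P b <= plurality_score P a)
          (a \in plurality P).
Proof.
rewrite !inE; apply: (iffP andP) => -[aA m]; split=> //.
  by move=> b bA; have /forallP/(_ [` bA]) := m.
by apply/forallP => b; apply: m (valP b).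
Qed.

Lemma plurality_listed N A (P : profile N A) f : listed P f ->
  plurality P = winners A (map f N).
Proof.
move=> Pf; have sE a : a \in A -> plurality_score P a = tops a (map f N).
  move=> aA; rewrite plurality_score_count /tops count_map.
  apply: eq_in_count => i iN /=; have [fA PE] := Pf i iN.
  have af : a \in f i by rewrite (perm_mem fA).
  transitivity (index a (f i) == 0); last first.
    case: (f i) af => //= c l _.
    by rewrite -[Some c == Some a]/(c == a); case: (c == a).
  apply/allP/eqP => [h|h b bA]; last by rewrite PE // h ltn0.
  case E: (f i) => [|c l]; first by rewrite E in af.
  have cA : c \in A by rewrite -(perm_mem fA) E mem_head.
  have := h c cA; rewrite PE // E /= eqxx.
  by case: (c == a).
apply/fsetP => a; apply/pluralityP/winnersP => -[aA m]; split=> // b bA.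
  by rewrite -!sE ?m.
by rewrite !sE ?m.
Qed.

Lemma top_exists N A (P : profile N A) : N != fset0 -> A != fset0 ->
  exists2 c, c \in A & 0 < plurality_score P c.
Proof.
move=> /fset0Pn[i iN] /fset0Pn[a aA]; have [f /(_ i iN)[fA PE]] := listed_exists P.
case E: (f i) => [|c l].
  by have := perm_mem fA a; rewrite E aA.
have cA : c \in A by rewrite -(perm_mem fA) E mem_head.
exists c => //; rewrite plurality_score_count -has_count; apply/hasP; exists i => //.
by apply/allP => b bA; rewrite PE // E /= eqxx ltn0.
Qed.

End ListedProfiles.

(** * Plurality satisfies the axioms *)

Section PluralityAxioms.
Variables (V X : choiceType) (mbar : nat) (F : social_choice_rule V X mbar).
Hypothesis FP : is_plurality F.

(** Converts bijections into permutations of enumerations, along which counts are moved. *)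
Lemma set_bij_perm (T : choiceType) (B C : {fset T}) (s : T -> T) :
  set_bij [set` B] [set` C] s -> perm_eq (map s B) C.
Proof.
case=> fs inj surj; apply: uniq_perm; rewrite ?fset_uniq //.
  by rewrite map_inj_in_uniq ?fset_uniq // => x y xB yB; apply: inj; rewrite inE.
move=> x; apply/mapP/idP => [[y yB ->]|xC]; first exact: fs.
by have [y yB <-] := surj x xC; exists y.
Qed.

Lemma plurality_anonymity : anonymity F.
Proof.
move=> N N' A pi P Q adP adQ pi_bij PQ; rewrite !FP //.
have piN := set_bij_perm pi_bij.
have sE a : a \in A -> plurality_score Q a = plurality_score P a.
  move=> aA; rewrite !plurality_score_count -(permP piN) count_map.
  apply: eq_in_count => i iN /=; apply: eq_in_all => b bA.
  by rewrite PQ.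
apply/fsetP => a; apply/pluralityP/pluralityP => -[aA m]; split=> // b bA.
  by rewrite -!sE ?m.
by rewrite !sE ?m.
Qed.

Lemma plurality_neutrality : neutrality F.
Proof.
move=> N A s P Q ad s_bij PQ; rewrite !FP //.
have sA := set_bij_perm s_bij.
have memA a : a \in A -> s a \in A by move=> aA; rewrite -(perm_mem sA) map_f.
have sE a : a \in A -> plurality_score Q (s a) = plurality_score P a.
  move=> aA; rewrite !plurality_score_count; apply: eq_in_count => i iN /=.
  rewrite -(perm_all _ sA) all_map; apply: eq_in_all => b bA /=.
  by rewrite PQ.
have onto c : c \in A -> exists2 a, a \in A & c = s a.
  by rewrite -(perm_mem sA) => /mapP.
apply/fsetP => c; apply/pluralityP/imfsetP => [[/onto[a aA ->] m]|[a /= /pluralityP[aA m] ->]].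
  exists a => //=; apply/pluralityP; split=> // b bA.
  by rewrite -!sE // m // memA.
by split=> [|_ /onto[b bA ->]]; rewrite ?memA // !sE // m.
Qed.

Lemma plurality_consistency : consistency F.
Proof.
move=> N N' A P P' Q adP adP' dNN' [QP QP'].
have adQ : admissible mbar (N `|` N') A.
  case/and3P: adP => /fset0Pn[i iN] A0 Am; rewrite /admissible A0 Am andbT /=.
  by rewrite andbT; apply/fset0Pn; exists i; rewrite inE iN.
rewrite !FP //.
have pN : perm_eq (N `|` N') (N ++ N').
  apply: uniq_perm; rewrite ?cat_uniq ?fset_uniq //= ?andbT.
    apply/hasPn => i iN'; apply/negP => iN.
    by move/fdisjointP: dNN' => /(_ i iN) /negP; apply.
  by move=> i; rewrite in_fsetU mem_cat.
have sE a : a \in A ->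
    plurality_score Q a = (plurality_score P a + plurality_score P' a)%N.
  move=> aA; rewrite !plurality_score_count (permP pN) count_cat.
  congr (_ + _)%N; apply: eq_in_count => i iN /=; apply: eq_in_all => b bA.
    by rewrite QP.
  by rewrite QP'.
case/fset0Pn=> z /fsetIP[/pluralityP[zA mz] /pluralityP[_ mz']].
apply/fsetP => a; rewrite in_fsetI; apply/pluralityP/andP.
  (* Since [z] wins in both parts, a winner of the union must score exactly as much as [z] in each
     part. *)
  case=> aA m; have := m z zA; rewrite !sE //.
  have := mz a aA; have := mz' a aA => h1 h2 h3.
  by split; apply/pluralityP; split=> // b bA; [have := mz b bA|have := mz' b bA]; lia.
case=> /pluralityP[aA m] /pluralityP[_ m']; split=> // b bA.
by rewrite !sE // leq_add ?m ?m'.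
Qed.

Lemma plurality_clone_invariance : one_clone_invariance F.
Proof.
move=> N A x x' P Q adP adQ xA x'A [[AA QP] _ xx']; rewrite !FP //.
have sE a : a \in A -> plurality_score Q a = plurality_score P a.
  move=> aA; rewrite !plurality_score_count; apply: eq_in_count => i iN /=.
  apply/allP/allP => h b; first by move=> bA; rewrite QP // h // !inE bA orbT.
  rewrite !inE => /orP[/eqP ->|bA]; last by rewrite -QP // h.
  (* Whatever lies below [x'] lies below [x] as well, so the clone takes no top away from anyone. *)
  apply/negP => x'a; have xa := pref_trans (xx' i iN) x'a.
  by have := h x xA; rewrite QP // xa.
have s0 : plurality_score Q x' = 0.
  rewrite plurality_score_count; apply/eqP; rewrite -leqn0 leqNgt -has_count.
  apply/hasPn => i iN; apply/allPn; exists x; first by rewrite !inE xA orbT.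
  by rewrite xx'.
(* The positive score of [c] keeps [x'], whose score is 0, from winning. *)
have [c cA c0] : exists2 c, c \in A & 0 < plurality_score P c.
  by case/and3P: adP => *; apply: top_exists.
apply/fsetP => a; apply/pluralityP/pluralityP => -[].
  rewrite in_fset1U => /orP[/eqP ->|aA] m.
    by have := m c; rewrite in_fset1U cA orbT => /(_ isT); rewrite s0 sE // leqNgt c0.
  by split=> // b bA; rewrite -!sE // m // in_fset1U bA orbT.
move=> aA m; split; first by rewrite in_fset1U aA orbT.
move=> b; rewrite in_fset1U => /orP[/eqP ->|bA]; first by rewrite s0.
by rewrite !sE // m.
Qed.

End PluralityAxioms.


(** Turns equality of ballots up to order into the bijection of voters that anonymity asks for. *)
Lemma perm_map_reindex (S : choiceType) (T : eqType) (f g : S -> T)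
    (B C : {fset S}) : perm_eq (map f B) (map g C) ->
  exists2 s, set_bij [set` B] [set` C] s & forall i, i \in B -> g (s i) = f i.
Proof.
have [->|/fset0Pn[x0 _]] := eqVneq B fset0.
  move/perm_size; rewrite !size_map /= => sz.
  have -> : C = fset0 by apply/eqP; rewrite -cardfs_eq0 -sz.
  by exists id => //; split=> [x|x y|x] //; rewrite inE.
move=> /(perm_iotaP (f x0))[Is pIs fE]; rewrite size_map in pIs.
(* [t] enumerates [C] in an order along which [g] takes the values that [f] takes along [B]; the
   bijection matches positions. *)
pose t := map (nth x0 C) Is.
have tC : perm_eq t C.
  rewrite -[X in perm_eq _ X](mkseq_nth x0); exact: perm_map.
have fgt : map f B = map g t.
  rewrite fE -map_comp; apply/eq_in_map => k.
  by rewrite (perm_mem pIs) mem_iota /= => kC; rewrite (nth_map x0).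
have szBt : size B = size t by rewrite -(size_map f) fgt size_map.
have ut : uniq t by rewrite (perm_uniq tC) fset_uniq.
exists (fun i => nth x0 t (index i B)).
  split=> [i /= iB|i j|j /= jC].
  - by rewrite -(perm_mem tC) mem_nth // -szBt index_mem.
  - rewrite !inE /= => iB jB /eqP; rewrite nth_uniq -?szBt ?index_mem //.
    by move/eqP; apply: (index_inj i).
  - have jt : j \in t by rewrite (perm_mem tC).
    have jB : index j t < size B by rewrite szBt index_mem.
    exists (nth x0 B (index j t)); first by rewrite /= mem_nth.
    by rewrite index_uniq ?fset_uniq // nth_index.
move=> i iB; have iB' : index i B < size t by rewrite -szBt index_mem.
rewrite -(nth_map x0 (f x0)) // -fgt (nth_map x0) ?szBt //.
by rewrite nth_index.
Qed.

Lemma index_rem_lt (T : eqType) (z a b : T) r : a != z -> b != z ->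
  (index a (rem z r) < index b (rem z r)) = (index a r < index b r).
Proof.
move=> az bz; elim: r => //= c r IHr; case: (eqVneq c z) => [->|_] /=.
  by rewrite ![z == _]eq_sym (negPf az) (negPf bz).
by case: (c == a); case: (c == b) => //; rewrite !ltnS.
Qed.

(** * From a social choice rule to a ballot rule *)

Section Electorates.
Variables (V X : choiceType) (v : nat -> V).
Hypothesis v_inj : injective v.
Implicit Types (A : {fset X}) (L : seq (seq X)).

(** Ballots go to consecutive terms of the sequence [v]; the offset [n] makes room for disjoint
    electorates. *)
Definition voters n L := map v (iota n (size L)).

Definition electorate n L : {fset V} := [fset i in voters n L].

Definition ballot n L i := nth [::] L (index i (voters n L)).

Lemma electorate_perm n L : perm_eq (electorate n L) (voters n L).
Proof.
apply: uniq_perm; rewrite ?fset_uniq ?(map_inj_uniq v_inj) ?iota_uniq // => i.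
by rewrite !inE.
Qed.

Lemma perm_ballots n L : perm_eq (map (ballot n L) (electorate n L)) L.
Proof.
rewrite (permPl (perm_map _ (electorate_perm n L))).
suff -> : map (ballot n L) (voters n L) = L by [].
have szv : size (voters n L) = size L by rewrite size_map size_iota.
have uv : uniq (voters n L) by rewrite (map_inj_uniq v_inj) iota_uniq.
apply: (@eq_from_nth _ [::]) => [|k]; rewrite size_map szv // => kL.
by rewrite (nth_map (v 0)) ?szv // /ballot index_uniq ?szv.
Qed.

Lemma electorate_neq0 n L : L != [::] -> electorate n L != fset0.
Proof.
case: L => // r L _; apply/fset0Pn; exists (v n).
by rewrite (perm_mem (electorate_perm n _)) mem_head.
Qed.

Lemma mem_ballot n L i : i \in electorate n L -> ballot n L i \in L.
Proof. by move=> iN; rewrite -(perm_mem (perm_ballots n L)) map_f. Qed.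

Lemma rankings_ballot n L A i : rankings A L -> i \in electorate n L ->
  perm_eq (ballot n L i) A.
Proof. by move=> /allP LA /(@mem_ballot n L) /LA. Qed.

Lemma electorate_disjoint L L' :
  [disjoint electorate 0 L & electorate (size L) L'].
Proof.
apply/fdisjointP => i; rewrite !inE => /mapP[j jL ->].
rewrite (mem_map v_inj) mem_iota; apply/negP => /andP[h _].
by move: jL; rewrite mem_iota /= add0n ltnNge h.
Qed.

Variables (mbar : nat) (F : social_choice_rule V X mbar).
Hypotheses (Fan : anonymity F) (Fne : neutrality F) (Fco : consistency F)
  (Fcl : one_clone_invariance F).

Lemma choice_listed (N N' : {fset V}) A (P : profile N A) (Q : profile N' A) f g :
  listed P f -> listed Q g -> admissible mbar N A -> admissible mbar N' A ->
  perm_eq (map f N) (map g N') -> F N A P = F N' A Q.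
Proof.
move=> Pf Qg adP adQ /perm_map_reindex[s sbij sE].
apply/esym; apply: (Fan adP adQ sbij) => i a b iN aA bA.
have sN : s i \in N' by have [h _ _] := sbij; apply: h.
by rewrite (Pf i iN).2 // (Qg _ sN).2 // sE.
Qed.

(** Numbering the voters from 0 is an arbitrary choice, immaterial by anonymity, as
    [choice_ballot_choice] shows. *)
Definition ballot_choice A L : {fset X} :=
  F (electorate 0 L) A (list_profile (electorate 0 L) A (ballot 0 L)).

Lemma choice_ballot_choice (N : {fset V}) A (P : profile N A) f L :
  listed P f -> admissible mbar N A -> perm_eq (map f N) L ->
  F N A P = ballot_choice A L.
Proof.
move=> Pf adP fL; have /and3P[N0 A0 Am] := adP.
have LA : rankings A L.
  apply/allP => r; rewrite -(perm_mem fL) => /mapP[i iN ->].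
  by have [] := Pf i iN.
have L0 : L != [::].
  case: (L) fL => // /perm_size; rewrite size_map => /= /eqP sz.
  by rewrite cardfs_eq0 (negPf N0) in sz.
have Ql := listed_list_profile (fun i => @rankings_ballot 0 L A i LA).
apply: (choice_listed Pf Ql) => //.
  by rewrite /admissible electorate_neq0 // A0.
by rewrite (permPl fL) perm_sym perm_ballots.
Qed.

Lemma ballot_choice_rule : ballot_rule mbar ballot_choice.
Proof.
have ad n A L : A != fset0 -> #|` A| <= mbar -> L != [::] ->
    admissible mbar (electorate n L) A.
  by move=> A0 Am L0; rewrite /admissible electorate_neq0 // A0.
have li n A L : rankings A L ->
    listed (list_profile (electorate n L) A (ballot n L)) (ballot n L).
  by move=> LA; apply: listed_list_profile => i; exact: rankings_ballot.
split.
- by move=> A L A0 Am L0 LA; apply: choice_neq0; apply: ad.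
- by move=> A L A0 Am L0 LA; apply: choice_sub; apply: ad.
- move=> A L L' A0 Am L0 LA LL'; apply: (choice_ballot_choice (li _ _ _ LA)).
    exact: ad.
  by rewrite -(permPr LL') perm_ballots.
- move=> A L a b A0 Am L0 LA aA bA.
  set N := electorate 0 L; pose f := map (transp a b) \o ballot 0 L.
  have fA i : i \in N -> perm_eq (f i) A.
    by move=> iN; apply: perm_map_transp => //; apply: rankings_ballot iN.
  have Qf := listed_list_profile fA.
  rewrite -(choice_ballot_choice Qf); last 2 first.
  + exact: ad.
  + by rewrite map_comp perm_map // perm_ballots.
  apply: Fne; first exact: ad.
    split=> [x /= xA|x y _ _|x /= xA]; [|exact: transp_inj|].
      by rewrite transp_mem.
    by exists (transp a b x); rewrite ?transpK //= transp_mem.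
  move=> i c d iN cA dA; rewrite (Qf i iN).2 ?transp_mem //.
  by rewrite (li _ _ _ LA i iN).2 // !index_map //; apply: transp_inj.
- move=> A L L' A0 Am L0 L'0 LA L'A.
  set N := electorate 0 L; set N' := electorate (size L) L'.
  have dNN' : [disjoint N & N'] by exact: electorate_disjoint.
  have notN i : i \in N' -> (i \in N) = false.
    by move=> iN'; apply/negbTE; move/fdisjointP_sym: dNN' => /(_ i iN').
  (* Anonymity moves [L'] to voters numbered from [size L] on, disjoint from those of [L] as
     consistency requires. *)
  have N'L' : ballot_choice A L' =
      F N' A (list_profile N' A (ballot (size L) L')).
    apply/esym; apply: (choice_ballot_choice (li _ _ _ L'A)).
      exact: ad.
    exact: perm_ballots.
  pose f i := if i \in N then ballot 0 L i else ballot (size L) L' i.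
  have fN i : i \in N -> f i = ballot 0 L i by rewrite /f => ->.
  have fN' i : i \in N' -> f i = ballot (size L) L' i.
    by move=> iN'; rewrite /f notN.
  have fA i : i \in N `|` N' -> perm_eq (f i) A.
    rewrite in_fsetU => /orP[iN|iN].
      by rewrite fN // (rankings_ballot LA iN).
    by rewrite fN' // (rankings_ballot L'A iN).
  have Qf := listed_list_profile fA.
  have NU i : i \in N -> i \in N `|` N' by rewrite in_fsetU => ->.
  have N'U i : i \in N' -> i \in N `|` N' by rewrite in_fsetU orbC => ->.
  rewrite N'L' => I0; rewrite -(choice_ballot_choice Qf).
  + apply: Fco => //; [exact: ad|exact: ad|].
    split=> i a b iN aA bA.
      by rewrite (Qf i (NU i iN)).2 // fN // (li _ _ _ LA i iN).2.
    by rewrite (Qf i (N'U i iN)).2 // fN' // (li _ _ _ L'A i iN).2.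
  + have /and3P[/fset0Pn[k kN] _ _] := ad 0 A L A0 Am L0.
    by rewrite /admissible A0 Am !andbT; apply/fset0Pn; exists k; apply: NU.
  + have pN : perm_eq (N `|` N') (N ++ N').
      apply: uniq_perm; rewrite ?cat_uniq ?fset_uniq //= ?andbT.
        by apply/hasPn => i iN'; rewrite /= notN.
      by move=> i; rewrite in_fsetU mem_cat.
    rewrite (permPl (perm_map _ pN)) map_cat; apply: perm_cat.
      have -> : map f N = map (ballot 0 L) N by apply/eq_in_map.
      exact: perm_ballots.
    have -> : map f N' = map (ballot (size L) L') N' by apply/eq_in_map.
    exact: perm_ballots.
- move=> A L d z A0 Am L0 LA dA zA dz Linf.
  set N := electorate 0 L; set B := A `\ z.
  have AE : z |` B = A by exact: fsetD1K.
  have dB : d \in B by rewrite !inE dz.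
  have B0 : B != fset0 by apply/fset0Pn; exists d.
  have Bm : #|` B| <= mbar by rewrite (leq_trans _ Am) // fsubset_leq_card // fsubD1set.
  pose f := rem z \o ballot 0 L.
  have LB : rankings B (map (rem z) L) by apply: rankings_clone.
  have fB i : i \in N -> perm_eq (f i) B.
    by move=> iN; apply: (allP LB); rewrite /f /= map_f // mem_ballot.
  have Pf := listed_list_profile fB.
  rewrite -(choice_ballot_choice Pf); last 2 first.
  + by rewrite /admissible electorate_neq0 // B0.
  + by rewrite map_comp perm_map // perm_ballots.
  (* The agenda is rewritten as [B] with [z] added, the form in which clone extensions are typed. *)
  rewrite -AE in LA Am A0 *.
  have Ql := li 0 _ _ LA.
  have zdz : z \in z |` B by rewrite !inE eqxx.
  have ddz : d \in z |` B by rewrite in_fset1U dB orbT.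
  have zB : z \notin B by rewrite !inE eqxx.
  (* Adjacency in the ballot becomes consecutive positions, so the two ranks differ by exactly 1 and
     [d] comes first. *)
  have idx i : i \in N ->
      index z (ballot 0 L i) = (index d (ballot 0 L i)).+1.
    move=> iN; have /infixP[p [q rE]] := allP Linf _ (mem_ballot iN).
    have := rankings_ballot LA iN; rewrite rE => /perm_uniq.
    rewrite fset_uniq cat_uniq /= !inE !negb_or -!andbA => /and4P[_ dp zp _].
    rewrite !index_cat (negPf dp) (negPf zp) /= !eqxx (negPf dz).
    by rewrite addn0 addn1.
  apply: (Fcl (x := d) (P := list_profile N B f)) => //; [exact: ad|exact: ad|split].
  + split=> [|i a b iN aB bB]; first by rewrite fsubsetU1.
    rewrite (Pf i iN).2 // (Ql i iN).2 ?in_fset1U ?aB ?bB ?orbT //.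
    by rewrite /f /= index_rem_lt //; apply: contraNneq zB => <-.
  + by move=> i iN; rewrite (rank_listed Ql iN ddz) (rank_listed Ql iN zdz) idx //; clear; lia.
  + by move=> i iN; rewrite (Ql i iN).2 // idx.
Qed.

Lemma axioms_plurality : is_plurality F.
Proof.
move=> N A P adP; have [f Pf] := listed_exists P.
have /and3P[N0 A0 Am] := adP.
rewrite (choice_ballot_choice Pf adP (perm_refl _)) (plurality_listed Pf).
apply: (ballot_rule_plurality ballot_choice_rule) => //.
  exact: map_fset_neq0.
by apply/allP => _ /mapP[i /Pf[? _] ->].
Qed.

End Electorates.

(** * The characterisation of plurality *)

Lemma infinite_injection (T : choiceType) :
  infinite_set [set: T]%classic -> exists v : nat -> T, injective v.
Proof.
move=> /infiniteP /card_leP[g].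
exists (fun n => val (g (to_setT n))) => m n /val_inj gmn.
by apply: (@inj _ _ setT to_setT); rewrite ?inE //; apply: (@inj _ _ setT g); rewrite ?inE.
Qed.

Theorem theorem1 (V X : choiceType)
    (hV : infinite_set [set: V]%classic) (hX : infinite_set [set: X]%classic)
    (mbar : nat) (hm : (3 <= mbar)%N) (F : social_choice_rule V X mbar) :
  (anonymity F /\ neutrality F /\ consistency F /\ one_clone_invariance F)
  <-> is_plurality F.
Proof.
split=> [[Fan [Fne [Fco Fcl]]]|FP].
  have [v v_inj] := infinite_injection hV.
  exact: (axioms_plurality v_inj).
split; first exact: plurality_anonymity.
split; first exact: plurality_neutrality.
split; first exact: plurality_consistency.
exact: plurality_clone_invariance.
Qed.
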